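(* There exist an ergodic dynamical system $(X,\mathcal{A},\mu,T)$ and a function $f\in L^{\infty}(\mu)$ such that for $\mu$-a.e. $x\in X$ one can find bounded sequences $A_i=(a_{i,n})_n\in\mathcal{WW}_1$, $1\le i\le 6$, for which the averages $$M_N(A_1,\dots,A_6,f)(x)=\frac{1}{N^3}\sum_{n,m,p=0}^{N-1}a_{1,p}\,a_{2,n}\,a_{3,p+n}\,a_{4,m}\,a_{5,n+m}\,a_{6,p+m}\,f(T^{n+m+p}x)$$ do not converge as $N\to\infty$.
   Context: $\mathcal{WW}_1$ denotes the set of bounded sequences $a=(a_n)$ of (complex) scalars such that $\lim_{N}\frac{1}{N}\sum_{n=1}^N a_n e^{2\pi i n t}$ exists for each $t\in\mathbb{R}$. An ergodic dynamical system is an ergodic measure preserving transformation of a probability space. The sequences $A_i$ are allowed to depend on $x$. *)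

(* Defs.v *)
From mathcomp Require Export all_boot all_order all_algebra.
From mathcomp Require Export complex.
From mathcomp Require Export all_classical all_reals all_analysis.
Export numFieldNormedType.Exports.

Set Implicit Arguments.
Unset Strict Implicit.
Unset Printing Implicit Defensive.

Import Order.TTheory GRing.Theory Num.Theory.

Local Open Scope classical_set_scope.
Local Open Scope complex_scope.
Local Open Scope ring_scope.

Section ergodic_systems.
Context (R : realType) (d : measure_display) (X : measurableType d).

Definition measure_preserving (mu : probability X R) (T : X -> X) : Prop :=
  measurable_fun setT T /\
  forall A : set X, measurable A -> mu (T @^-1` A) = mu A.

Definition ergodic (mu : probability X R) (T : X -> X) : Prop :=
  measure_preserving mu T /\
  forall A : set X, measurable A -> T @^-1` A = A ->
    mu A = 0%E \/ mu A = 1%E.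

(* The library's [Lfun] is only available for real-valued functions; the
   measurable structure on [R[i]] is the Borel sigma-algebra. *)
Definition complex_Linfty (mu : probability X R) (f : X -> R[i]) : Prop :=
  measurable_fun setT (f : X -> g_sigma_algebraType (@open R[i]^o)) /\
  ('N[mu]_+oo [(fun x => (ComplexField.Normc.normc (f x))%:E)] < +oo)%E.

End ergodic_systems.

Section weights.
Context (R : realType).

Definition cexp2pi (t : R) : R[i] := cos (2 * pi * t) +i* sin (2 * pi * t).

Definition WW1 (a : nat -> R[i]) : Prop :=
  bounded_fun (a : nat -> R[i]^o) /\
  forall t : R,
    cvg ((fun N : nat =>
      N%:R^-1 * \sum_(1 <= n < N.+1) a n * cexp2pi (n%:R * t) : R[i]^o) @ \oo).

Definition cubic_average (X : Type) (T : X -> X)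
    (a1 a2 a3 a4 a5 a6 : nat -> R[i]) (f : X -> R[i]) (x : X) (N : nat) : R[i]^o :=
  (N%:R ^+ 3)^-1 *
  \sum_(n < N) \sum_(m < N) \sum_(p < N)
    a1 p * a2 n * a3 (p + n)%N * a4 m * a5 (n + m)%N * a6 (p + m)%N *
    f (iter (n + m + p)%N T x).

End weights.

(* Main.v *)
(* The system is a single point and f = 1, so the whole obstruction is carried by
   the weights.  On the block 16^k <= n < 16^(k+1) put
   a_1(n) = (-1)^k w_k^n, a_2(n) = w_k^n, a_3(n) = w_k^(-n), and let
   a_4 = a_5 = a_6 = 1, where the w_k are distinct points of the unit circle
   tending slowly to 1.  A fixed frequency resonates with at most one w_k, so
   summing geometric progressions over the blocks shows that every
   Wiener-Wintner average of a_1, a_2, a_3 tends to 0.  But for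
   n, p >= 16^k with n + p < 16^(k+1) the product a_1(p) a_2(n) a_3(p+n) equals
   (-1)^k, and for N = 8 * 16^k such pairs are at least three quarters of all pairs,
   so that the cubic averages oscillate. *)
Require Import Defs.
From mathcomp Require Import ring zify.

Set Implicit Arguments.
Unset Strict Implicit.
Unset Printing Implicit Defensive.

Import Order.TTheory GRing.Theory Num.Theory.

Local Open Scope classical_set_scope.
Local Open Scope complex_scope.
Local Open Scope ring_scope.

(** * Complex exponentials and geometric sums *)

Lemma complex_archi (R : realType) (x : R[i]) : exists n : nat, `|x| < n%:R.
Proof.
exists (Num.truncn (Num.sqrt (complex.Re x ^+ 2 + complex.Im x ^+ 2))).+1.
rewrite normc_def -(rmorph_nat (real_complex R)) ltcR.
by rewrite truncnS_gt.
Qed.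

Lemma cexp2piM (R : realType) (n : nat) (t : R) :
  cexp2pi (n%:R * t) = cexp2pi t ^+ n.
Proof.
elim: n => [|n IHn]; first by rewrite mul0r /cexp2pi mulr0 cos0 sin0 expr0.
rewrite exprSr -IHn /cexp2pi.
have -> : 2 * pi * (n.+1%:R * t) = 2 * pi * (n%:R * t) + 2 * pi * t by ring.
rewrite cosD sinD.
by simpc; rewrite [X in _ +i* X]addrC.
Qed.

Lemma norm_cexp2pi (R : realType) (t : R) : `|cexp2pi t| = 1.
Proof. by rewrite normc_def /= cos2Dsin2 sqrtr1. Qed.

(** Multiplying by [1 - x] telescopes the sum to a difference of two numbers of modulus 1. The
    product form also covers [x = 1]. *)
Lemma geometric_sum_bound (F : numFieldType) (x : F) (A B : nat) :
  (A <= B)%N -> `|x| = 1 -> `|\sum_(A <= n < B) x ^+ n| * `|1 - x| <= 2.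
Proof.
move=> leAB x1; rewrite -normrM mulr_suml.
have -> : \sum_(A <= n < B) x ^+ n * (1 - x) = - (x ^+ B - x ^+ A).
  rewrite -(telescope_sumr _ leAB) -sumrN.
  by apply: eq_bigr => n _; rewrite exprSr; ring.
rewrite normrN (le_trans (ler_normB _ _)) // !normrX x1 !expr1n.
by rewrite -natr1.
Qed.

Definition block (n : nat) : nat := trunc_log 16 n.

Lemma block_eq (k n : nat) : (16 ^ k <= n < 16 ^ k.+1)%N -> block n = k.
Proof. by move=> kn; apply: trunc_log_eq. Qed.

Lemma WW1_cst1 (R : realType) : WW1 (cst 1 : nat -> R[i]).
Proof.
split; first by exists 1; split=> [|M M1 n _ /=]; rewrite ?real1 ?normr1 ?ltW.
move=> t; pose z := cexp2pi t; have z1 : `|z| = 1 := norm_cexp2pi t.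
have -> : (fun N : nat => N%:R^-1 *
      \sum_(1 <= n < N.+1) cst 1 n * cexp2pi (n%:R * t) : R[i]^o) =
    (fun N : nat => N%:R^-1 * \sum_(1 <= n < N.+1) z ^+ n : R[i]^o).
  apply/funext => N; congr (_ * _).
  by apply: eq_bigr => n _; rewrite cexp2piM mul1r.
(* The only resonance is at [z = 1], where the averages equal 1 for N > 0; otherwise the sums are
   bounded by 2 / |1 - z| and the averages tend to 0. *)
have [->|z_neq1] := eqVneq z 1.
  apply/cvg_ex; exists 1; apply: cvg_near_cst; exists 1%N => // N /= N0.
  under eq_bigr do rewrite expr1n.
  by rewrite big_const_nat iter_addr addr0 subn1 mulVf // pnatr_eq0 -lt0n.
apply/cvg_ex; exists 0; apply/cvgr0Pnorm_lt => e e0.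
have d0 : 0 < `|1 - z| by rewrite normr_gt0 subr_eq0 eq_sym.
have [M DM] := complex_archi (2 / `|1 - z| / e).
exists M.+1 => // N /= MN.
rewrite normrM normfV normr_nat mulrC ltr_pdivrMr ?ltr0n ?(leq_trans _ MN) //.
have := geometric_sum_bound (ltn0Sn N) z1; rewrite -ler_pdivlMr // => /le_lt_trans; apply.
rewrite ger0_norm in DM; last by rewrite !divr_ge0 ?ler0n // ltW.
rewrite (ltr_pdivrMr _ _ e0) in DM.
rewrite [ltRHS]mulrC (lt_le_trans DM) // ler_pM2r // ler_nat.
exact: ltnW.
Qed.

(** * Wiener-Wintner averages of block waves *)

Section block_waves.
Context (R : realType).
Implicit Types (c w : nat -> R[i]) (z C D : R[i]).

Definition block_wave c w (n : nat) : R[i] := c (block n) * w (block n) ^+ n.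

(* The frequencies [w k] stay at distance at least of order [1/k] from every
   fixed frequency, at most finitely many [k] excepted. *)
Definition spread w : Prop := forall z, `|z| = 1 ->
  exists C K, 0 <= C /\
    forall k, (K <= k)%N -> 1 <= C * k.+1%:R * `|1 - w k * z|.

Lemma norm_block_wave c w n : (forall k, `|c k| = 1) -> (forall k, `|w k| = 1) ->
  `|block_wave c w n| = 1.
Proof. by move=> c1 w1; rewrite normrM normrX c1 w1 expr1n mulr1. Qed.

(** Within block k the summand is [c k] times a power of [w k * z], so the geometric bound applies,
    and the lower bound on |1 - w_k z| makes it linear in k. *)
Lemma block_wave_sum_bound c w z C k A B :
    (forall k, `|c k| = 1) -> (forall k, `|w k| = 1) -> `|z| = 1 ->
    1 <= C * k.+1%:R * `|1 - w k * z| -> 0 <= C ->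
    (16 ^ k <= A <= B)%N -> (B <= 16 ^ k.+1)%N ->
  `|\sum_(A <= n < B) block_wave c w n * z ^+ n| <= 2 * C * k.+1%:R.
Proof.
move=> c1 w1 z1 Cwz C0 /andP[kA AB] Bk.
have -> : \sum_(A <= n < B) block_wave c w n * z ^+ n =
    c k * \sum_(A <= n < B) (w k * z) ^+ n.
  rewrite mulr_sumr; apply: eq_big_nat => n /andP[An nB].
  by rewrite /block_wave (@block_eq k) ?exprMn ?mulrA //; lia.
have wz1 : `|w k * z| = 1 by rewrite normrM w1 z1 mulr1.
have geo := geometric_sum_bound AB wz1.
set s := `|_|; have s0 : 0 <= s by exact: normr_ge0.
have sE : s = `|\sum_(A <= n < B) (w k * z) ^+ n| by rewrite /s normrM c1 mul1r.
rewrite -sE in geo.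
rewrite -[leLHS]mulr1 (le_trans (ler_wpM2l s0 Cwz)) //.
by rewrite mulrCA -mulrA [leRHS]mulrC ler_wpM2l ?mulr_ge0 ?ler0n.
Qed.

(** The terms before 16^K contribute at most 16^K, and each later block j at most 2C(j + 1); summing
    over the blocks gives quadratic growth in k. *)
Lemma block_wave_partial_sum_bound c w z :
    (forall k, `|c k| = 1) -> (forall k, `|w k| = 1) -> spread w -> `|z| = 1 ->
  exists D K, 0 <= D /\ forall k B, (K <= k)%N -> (16 ^ k <= B <= 16 ^ k.+1)%N ->
    `|\sum_(1 <= n < B) block_wave c w n * z ^+ n| <= D * (k.+1 ^ 2)%:R.
Proof.
move=> c1 w1 wS z1; have [C [K [C0 CK]]] := wS z z1.
pose S B := \sum_(1 <= n < B) block_wave c w n * z ^+ n.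
pose D0 : R[i] := (16 ^ K)%:R.
have step k B : (K <= k)%N -> (16 ^ k <= B <= 16 ^ k.+1)%N ->
    `|S B| <= `|S (16 ^ k)%N| + 2 * C * k.+1%:R.
  move=> Kk /andP[kB Bk]; rewrite /S (@big_cat_nat _ _ _ (16 ^ k)%N) ?expn_gt0 //=.
  rewrite (le_trans (ler_normD _ _)) // lerD2l.
  by apply: block_wave_sum_bound => //; [exact: CK|rewrite leqnn].
have start j : `|S (16 ^ (K + j))%N| <= D0 + 2 * C * ((K + j) ^ 2)%:R.
  elim: j => [|j IHj].
    rewrite addn0 (@le_trans _ _ D0) ?lerDl ?mulr_ge0 ?ler0n //.
    rewrite (le_trans (ler_norm_sum _ _ _)) // (@le_trans _ _ (\sum_(1 <= n < 16 ^ K) 1)) //.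
      by apply: ler_sum => n _; rewrite normrM norm_block_wave // normrX z1 expr1n mulr1.
    by rewrite big_const_nat iter_addr addr0 ler_nat leq_subr.
  rewrite addnS (le_trans (step (K + j)%N _ _ _)) ?leq_addr ?leqnn ?leq_exp2l ?leqnSn //.
  rewrite (le_trans (lerD IHj (lexx _))) // -addrA lerD2l -mulrDr -natrD.
  (* With q = K + j this is q^2 + (q + 1) <= (q + 1)^2. *)
  by apply: ler_wpM2l; rewrite ?mulr_ge0 ?ler0n // ler_nat; nia.
exists (D0 + 2 * C), K; split; first by rewrite addr_ge0 ?ler0n ?mulr_ge0 ?ler0n.
move=> k B Kk kB; rewrite (le_trans (step k B Kk kB)) //.
have := start (k - K)%N; rewrite subnKC // => IH.
rewrite (le_trans (lerD IH (lexx _))) // [leRHS]mulrDl -addrA lerD //.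
  by rewrite ler_peMr ?ler0n // ler1n expn_gt0.
by rewrite -mulrDr -natrD ler_wpM2l ?mulr_ge0 ?ler0n // ler_nat; nia.
Qed.

(** For N in block k the sum is O(k^2) while N >= 16^k, so every average tends to 0. *)
Lemma WW1_block_wave c w :
    (forall k, `|c k| = 1) -> (forall k, `|w k| = 1) -> spread w ->
  WW1 (block_wave c w).
Proof.
move=> c1 w1 wS; split.
  exists 1; split; first exact: real1.
  by move=> M M1 n _ /=; rewrite norm_block_wave // ltW.
move=> t; pose z := cexp2pi t; have z1 : `|z| = 1 := norm_cexp2pi t.
have [D [K [D0 DK]]] := block_wave_partial_sum_bound c1 w1 wS z1.
have -> : (fun N : nat => N%:R^-1 *
      \sum_(1 <= n < N.+1) block_wave c w n * cexp2pi (n%:R * t) : R[i]^o) =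
    (fun N : nat => N%:R^-1 *
      \sum_(1 <= n < N.+1) block_wave c w n * z ^+ n : R[i]^o).
  apply/funext => N; congr (_ * _).
  by apply: eq_bigr => n _; rewrite cexp2piM.
apply/cvg_ex; exists 0; apply/cvgr0Pnorm_lt => e e0.
have [M DM] := complex_archi (D / e).
(* Beyond this threshold the block index is at least K, so the sum bound holds, and at least M,
   which makes N large against D / e. *)
exists (16 ^ (maxn K M))%N => // N /= KMN.
pose k := block N.
have N0 : (0 < N)%N by rewrite (leq_trans _ KMN) ?expn_gt0.
have /andP[kN Nk] : (16 ^ k <= N < 16 ^ k.+1)%N by exact: trunc_log_bounds.
have KMk : (maxn K M <= k)%N by rewrite /k /block trunc_log_max.
(* The average includes n = N, so the excluded bound is N + 1, which may equal 16^(k+1). *)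
have := DK k N.+1; rewrite (leq_trans (leq_maxl K M)) // Nk (leq_trans kN) //.
move=> /(_ isT isT) sumN.
rewrite normrM normfV normr_nat mulrC ltr_pdivrMr ?ltr0n //.
apply: (le_lt_trans sumN).
rewrite ger0_norm ?ltr_pdivrMr // in DM; last exact: divr_ge0 D0 (ltW e0).
(* Split 16^k as 4^k * 4^k: one factor absorbs (k + 1)^2, the other M. *)
have k4 : (k.+1 ^ 2 <= 4 ^ k)%N.
  elim: (k) => // j IHj; rewrite [leqRHS]expnS.
  by apply: leq_trans (_ : 4 * j.+1 ^ 2 <= _)%N; [nia|rewrite leq_mul2l].
have Mk : (M <= 4 ^ k)%N.
  by rewrite (leq_trans (leq_maxr K M)) // (leq_trans KMk) // ltnW // ltn_expl.
have MN : (M * k.+1 ^ 2 <= N)%N.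
  by apply: leq_trans kN; rewrite (_ : 16 = 4 * 4)%N // expnMn leq_mul.
apply: (@lt_le_trans _ _ (M%:R * e * (k.+1 ^ 2)%:R)).
  by rewrite ltr_pM2r // ltr0n expn_gt0.
rewrite mulrAC mulrC -natrM.
by rewrite ler_pM2l // ler_nat.
Qed.

End block_waves.

(** * Unimodular frequencies tending slowly to 1 *)

Lemma norm1_1subMV (F : numFieldType) (w z : F) :
  `|w| = 1 -> `|z| = 1 -> `|1 - w^-1 * z| = `|1 - w * z^-1|.
Proof.
move=> w1 z1.
have w0 : w != 0 by rewrite -normr_eq0 w1 oner_eq0.
have z0 : z != 0 by rewrite -normr_eq0 z1 oner_eq0.
have -> : 1 - w^-1 * z = - (w^-1 * z) * (1 - w * z^-1) by field; rewrite w0 z0.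
by rewrite normrM normrN normrM normfV w1 z1 invr1 !mul1r.
Qed.

(** Inverting [w] amounts to testing [w] against [z^-1], up to a factor of modulus 1. *)
Lemma spreadV (R : realType) (w : nat -> R[i]) :
  (forall k, `|w k| = 1) -> spread w -> spread (fun k => (w k)^-1).
Proof.
move=> w1 wS z z1; have [|C [K [C0 CK]]] := wS z^-1.
  by rewrite normfV z1 invr1.
by exists C, K; split=> // k Kk; rewrite norm1_1subMV ?CK.
Qed.

Section frequencies.
Context (R : realType).

Definition shifted_i (k : nat) : R[i] := k%:R +i* 1.

(** The Cayley transform (k - i) / (k + i), whose distance to 1 is of exact order 1/k. *)
Definition freq (k : nat) : R[i] := (shifted_i k)^*%C / shifted_i k.

Lemma shifted_i_bounds k : k%:R <= `|shifted_i k| <= k.+1%:R.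
Proof.
rewrite normc_def /= -!(rmorph_nat (real_complex R)) !lecR expr1n.
apply/andP; split.
  by rewrite -[leLHS]ger0_norm ?ler0n // -sqrtr_sqr ler_wsqrtr // lerDl.
rewrite -[leRHS]ger0_norm ?ler0n // -sqrtr_sqr ler_wsqrtr // -!natrX natr1.
by rewrite ler_nat; nia.
Qed.

Lemma shifted_i_neq0 k : shifted_i k != 0.
Proof. by rewrite eq_complex /= oner_eq0 andbF. Qed.

Lemma norm_freq k : `|freq k| = 1.
Proof. by rewrite normrM normfV normcJ divff // normr_eq0 shifted_i_neq0. Qed.

Lemma norm_1subfreq k : `|1 - freq k| = 2 / `|shifted_i k|.
Proof.
have -> : 1 - freq k = (0 +i* 2) / shifted_i k.
  rewrite /freq -[1](divff (shifted_i_neq0 k)) -mulrBl; congr (_ / _).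
  by apply/eqP; rewrite eq_complex /= subrr opprK !eqxx.
rewrite normrM normfV; congr (_ / _).
rewrite normc_def /= expr0n add0r sqrtr_sqr ger0_norm ?ler0n //.
by rewrite -(rmorph_nat (real_complex R)).
Qed.

(** For [z = 1] the distance is 2 / |k + i| >= 2 / (k + 1). For any other [z], [freq k * z] tends to
    [z] and so finally stays at distance at least |1 - z| / 2 from 1. *)
Lemma spread_freq : spread freq.
Proof.
move=> z z1; have [->|z_neq1] := eqVneq z 1.
  exists 1, 0%N; split=> // k _; rewrite mulr1 mul1r norm_1subfreq.
  have /andP[_ uk] := shifted_i_bounds k.
  rewrite mulrA ler_pdivlMr ?normr_gt0 ?shifted_i_neq0 // mul1r.
  by rewrite (le_trans uk) // -natrM ler_nat leq_pmulr.
have d0 : 0 < `|1 - z| by rewrite normr_gt0 subr_eq0 eq_sym.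
set d := `|1 - z| in d0 *.
(* For k >= K > 4 / d one gets |1 - freq k| = 2 / |k + i| <= 2 / k <= d / 2. *)
have [K zK] := complex_archi (4 / d).
rewrite ger0_norm ?divr_ge0 ?ler0n ?ltW // in zK.
exists (2 / d), K; split; first by rewrite divr_ge0 ?ler0n ?ltW.
move=> k Kk.
have small : `|1 - freq k| <= d / 2.
  have /andP[ku _] := shifted_i_bounds k.
  rewrite norm_1subfreq ler_pdivrMr ?normr_gt0 ?shifted_i_neq0 //.
  rewrite (@le_trans _ _ (d / 2 * (4 / d))) //.
    by rewrite [leRHS](_ : _ = 2) //; field; exact: lt0r_neq0.
  rewrite ler_wpM2l ?divr_ge0 ?ler0n ?ltW // (lt_le_trans zK) // (le_trans _ ku) //.
  by rewrite ler_nat.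
have far : d / 2 <= `|1 - freq k * z|.
  have : d <= `|1 - freq k * z| + `|1 - freq k|.
    have -> : d = `|(1 - freq k * z) - (1 - freq k) * z| by rewrite /d; congr `|_|; ring.
    by rewrite (le_trans (ler_normB _ _)) // [X in _ + X]normrM z1 mulr1.
  rewrite -lerBlDr => /(le_trans _); apply.
  by rewrite lerBrDr (le_trans (lerD (lexx _) small)) // -splitr.
rewrite (@le_trans _ _ (2 / d * k.+1%:R * (d / 2))) //.
  by rewrite [leRHS](_ : _ = k.+1%:R) ?ler1n //; field; exact: lt0r_neq0.
by apply: ler_wpM2l => //; rewrite mulr_ge0 ?divr_ge0 ?ler0n ?ltW.
Qed.

End frequencies.

(** * Oscillation of the cubic averages *)

Lemma cubic_mean_const (F : numFieldType) (s : F) (N : nat) : (0 < N)%N ->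
  (N%:R ^+ 3)^-1 * \sum_(n < N) \sum_(m < N) \sum_(p < N) s = s.
Proof.
move=> N0; have NR : (N%:R : F) != 0 by rewrite pnatr_eq0 -lt0n.
rewrite !sumr_const !card_ord -(mulr_natr (s *+ N *+ N)) -(mulr_natr (s *+ N)).
by rewrite -(mulr_natr s); field.
Qed.

Section cubic_weights.
Context (R : realType).

Definition sgn_block (k : nat) : R[i] := (-1) ^+ k.

Definition wave1 := block_wave sgn_block (@freq R).
Definition wave2 := block_wave (cst 1) (@freq R).
Definition wave3 := block_wave (cst 1) (fun k => (@freq R k)^-1).

(** Both indices are below half of 16^(k+1), so [p + n] is still in block k; all three waves then
    use the same frequency and its powers cancel. *)
Lemma wave_product k n p :
    (16 ^ k <= n < 8 * 16 ^ k)%N -> (16 ^ k <= p < 8 * 16 ^ k)%N ->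
  wave1 p * wave2 n * wave3 (p + n) = (-1) ^+ k.
Proof.
move=> /andP[kn nk] /andP[kp pk].
rewrite /wave1 /wave2 /wave3 /block_wave !(@block_eq k); try by rewrite expnS; lia.
rewrite /sgn_block /cst !mul1r -(mulrA ((-1) ^+ k)) -exprD exprVn mulfK //.
by rewrite expf_neq0 // -normr_eq0 norm_freq oner_eq0.
Qed.

Lemma norm_sgn_block k : `|sgn_block k| = 1.
Proof. by rewrite normrX normrN1 expr1n. Qed.

Lemma norm_cst1 (k : nat) : `|cst 1 k : R[i]| = 1.
Proof. exact: normr1. Qed.

Lemma norm_freqV k : `|(@freq R k)^-1| = 1.
Proof. by rewrite normfV norm_freq invr1. Qed.

Lemma norm_wave_product n p : `|wave1 p * wave2 n * wave3 (p + n)| = 1.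
Proof.
rewrite 2!normrM !norm_block_wave ?mulr1 //.
- exact: norm_cst1.
- exact: norm_freqV.
- exact: norm_cst1.
- exact: norm_freq.
- exact: norm_sgn_block.
- exact: norm_freq.
Qed.

(** A term differs from the sign only if n or p is below 16^k = N / 8, and then by at most 2, so the
    mean error is at most 2 (1/8 + 1/8) = 1/2. *)
Lemma cubic_average_near_sign (X : Type) (T : X -> X) (x : X) k :
  `|cubic_average T wave1 wave2 wave3 (cst 1) (cst 1) (cst 1) (cst 1) x (8 * 16 ^ k)
    - (-1) ^+ k| <= 2^-1.
Proof.
set N := (8 * 16 ^ k)%N; set s : R[i] := (-1) ^+ k.
have N0 : (N%:R : R[i]) != 0 by rewrite pnatr_eq0 muln_eq0 expn_eq0.
(* Charging the error 2 to each small index separately gives the bound [g n + g p], which is easy to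
   sum. *)
pose g (n : nat) : R[i] := if (n < 16 ^ k)%N then 2 else 0.
have g0 n : 0 <= g n by rewrite /g; case: ifP.
have dist2 n p : `|wave1 p * wave2 n * wave3 (p + n) - s| <= 2.
  rewrite (le_trans (ler_normB _ _)) // norm_wave_product /s.
  by rewrite normrX normrN1 expr1n.
have dist n p : (n < N)%N -> (p < N)%N ->
    `|wave1 p * wave2 n * wave3 (p + n) - s| <= g n + g p.
  move=> nN pN.
  have [nk|kn] := ltnP n (16 ^ k).
    by rewrite (le_trans (dist2 n p)) // {1}/g nk lerDl.
  have [pk|kp] := ltnP p (16 ^ k).
    by rewrite (le_trans (dist2 n p)) // addrC {1}/g pk lerDl.
  by rewrite (@wave_product k) ?kn ?kp // subrr normr0 addr_ge0.
have sum_g : \sum_(n < N) g n = (2 * 16 ^ k)%:R.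
  rewrite /g -big_mkcond -(big_ord_widen N (fun=> 2)) ?leq_pmull //.
  by rewrite sumr_const card_ord -mulrnA.
rewrite -(cubic_mean_const s (_ : 0 < N)%N) ?muln_gt0 ?expn_gt0 //.
rewrite -mulrBr -sumrB normrM normfV normrX normr_nat.
rewrite mulrC ler_pdivrMr ?exprn_gt0 ?lt_def ?ler0n ?N0 //.
apply: (@le_trans _ _ (\sum_(n < N) \sum_(m < N) \sum_(p < N) (g n + g p))).
  rewrite (le_trans (ler_norm_sum _ _ _)) // ler_sum // => n _.
  rewrite -sumrB (le_trans (ler_norm_sum _ _ _)) // ler_sum // => m _.
  rewrite -sumrB (le_trans (ler_norm_sum _ _ _)) // ler_sum // => p _.
  by rewrite /= !mulr1 dist.
under eq_bigr do under eq_bigr do rewrite big_split sumr_const card_ord sum_g /=.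
under eq_bigr do rewrite sumr_const card_ord mulrnDl.
rewrite big_split /= sumr_const card_ord !sumrMnl sum_g -!mulrnA -natrD -natrX.
rewrite mulrC ler_pdivlMr ?ltr0n // -natrM ler_nat.
by rewrite addnn -muln2 3!expnS expn0 muln1 {3}/N; lia.
Qed.

(** A limit would lie within 1/4 + 1/2 of both 1 and -1, forcing 2 <= 3/2. *)
Lemma cubic_average_not_cvg (X : Type) (T : X -> X) (x : X) :
  ~ cvg (cubic_average T wave1 wave2 wave3 (cst 1) (cst 1) (cst 1) (cst 1) x @ \oo).
Proof.
move=> /cvg_ex[l /cvgrPdist_lt/(_ 4^-1)]; rewrite invr_gt0 ltr0n => /(_ isT)[M _ Ml].
have near_l j : (M <= j)%N -> `|l - (-1) ^+ j| <= 4^-1 + 2^-1.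
  move=> Mj; have jN : (M <= 8 * 16 ^ j)%N.
    have j16 := ltnW (ltn_expl j (isT : 1 < 16)%N).
    by rewrite (leq_trans Mj) // (leq_trans j16) // leq_pmull.
  have := lerD (ltW (Ml _ jN)) (cubic_average_near_sign T x j).
  by apply: le_trans; exact: ler_distD.
have : `|(-1) ^+ M - (-1) ^+ M.+1 : R[i]| = 2.
  rewrite exprS mulN1r opprK -mulr2n normrMn.
  by rewrite normrX normrN1 expr1n.
have := le_trans (ler_distD l ((-1) ^+ M) ((-1) ^+ M.+1)) (lerD (lexx _) (near_l _ (leqnSn M))).
move=> /le_trans; rewrite [`|_ - l|]distrC.
move=> /(_ _ (lerD (near_l _ (leqnn M)) (lexx _))) le2 eq2.
move: le2; rewrite eq2.
have -> : 4^-1 + 2^-1 + (4^-1 + 2^-1) = 3 / 2 :> R[i] by field.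
by rewrite ler_pdivlMr ?ltr0n // -natrM ler_nat.
Qed.

End cubic_weights.

Theorem proposition9 (R : realType) :
  exists (d : measure_display) (X : measurableType d)
         (mu : probability X R) (T : X -> X) (f : X -> R[i]),
    [/\ ergodic mu T,
        complex_Linfty mu f &
        {ae mu, forall x, exists a1 a2 a3 a4 a5 a6 : nat -> R[i],
          [/\ WW1 a1, WW1 a2 & WW1 a3] /\
          [/\ WW1 a4, WW1 a5 & WW1 a6] /\
          ~ cvg (cubic_average T a1 a2 a3 a4 a5 a6 f x @ \oo)}].
Proof.
exists _, unit, (dirac tt), id, (cst 1); split.
- split; first by split => //; exact: measurable_id.
  (* A Dirac mass takes only the values 0 and 1. *)
  move=> A _ _; have [Att|Att] := pselect (A tt).
    by right; rewrite /= diracE mem_set.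
  by left; rewrite /= diracE memNset.
- split; first exact: measurable_cst.
  rewrite unlock /=; case: ifP => // _.
  apply: (@le_lt_trans _ _ 1%E); last exact: ltry.
  apply/ess_sup_inf.ess_supP; apply: aeW => _ /=.
  by rewrite expr1n expr0n addr0 sqrtr1 normr1.
apply: aeW => x; exists (wave1 R), (wave2 R), (wave3 R), (cst 1), (cst 1), (cst 1).
have wave1_WW1 : WW1 (wave1 R).
  exact: WW1_block_wave (@norm_sgn_block R) (@norm_freq R) (@spread_freq R).
have wave2_WW1 : WW1 (wave2 R).
  exact: WW1_block_wave (@norm_cst1 R) (@norm_freq R) (@spread_freq R).
have wave3_WW1 : WW1 (wave3 R).
  apply: WW1_block_wave (@norm_cst1 R) (@norm_freqV R) _.
  exact: spreadV (@norm_freq R) (@spread_freq R).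
have one_WW1 := WW1_cst1 R.
split=> //; split=> //; exact: cubic_average_not_cvg.
Qed.
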